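(* Let $f:\mathbb{R}^n\to(-\infty,+\infty]$ be proper, lower semicontinuous and prox-bounded with threshold $\lambda_f>0$, let $0<\lambda<\lambda_f$, and let $x\in\operatorname{dom}\partial_p^\lambda f$. Then the following are equivalent: (a) $\partial_p^\lambda f(x)$ is a singleton; (b) $\operatorname{conv}(f+\lambda^{-1}j)$ is differentiable at $x$ and $\operatorname{conv}(f+\lambda^{-1}j)(x)=(f+\lambda^{-1}j)(x)$; (c) $h_\lambda f$ is differentiable at $x$ and $h_\lambda f(x)=f(x)$.
   Context: $j:=\frac12\|\cdot\|^2$. $e_\lambda f(x):=\inf_y\{f(y)+\frac1{2\lambda}\|y-x\|^2\}$; prox-bounded with threshold $\lambda_f=\sup\{\lambda>0:e_\lambda f(x)>-\infty\text{ for some }x\}$. $v\in\partial_p^\lambda f(x)$ iff $x\in\operatorname{dom}f$ and $f(y)\ge f(x)+\langle v,y-x\rangle-\frac1{2\lambda}\|y-x\|^2$ for all $y$. $h_\lambda f:=-e_\lambda(-e_\lambda f)$ is the $\lambda$-proximal hull. $\operatorname{conv}g$ is the convex hull of the function $g$. *)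

(* Defs.v *)
From HB Require Import structures.
From mathcomp Require Import all_boot all_order all_algebra.
From mathcomp Require Import all_classical all_reals all_analysis.
Set Implicit Arguments. Unset Strict Implicit. Unset Printing Implicit Defensive.
Import Order.TTheory GRing.Theory Num.Theory.
Import numFieldNormedType.Exports.
Local Open Scope classical_set_scope.
Local Open Scope ring_scope.

Section Defs.
Variables (R : realType) (n : nat).
Local Notation V := 'rV[R]_n.

Definition dotp (u v : V) : R := \sum_(i < n) u ord0 i * v ord0 i.
Definition jfun (u : V) : R := (dotp u u) / 2.

Definition proper_fun (f : V -> \bar R) : Prop :=
  (forall x, f x != -oo%E) /\ (exists x, f x != +oo%E).

Definition edom (f : V -> \bar R) : set V := [set x | f x \is a fin_num].

Definition moreau_env (lam : R) (f : V -> \bar R) (x : V) : \bar R :=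
  ereal_inf [set (f y + ((jfun (y - x)) / lam)%:E)%E | y in [set: V]].

Definition prox_bounded (f : V -> \bar R) : Prop :=
  exists lam : R, 0 < lam /\ exists x, (-oo < moreau_env lam f x)%E.

Definition prox_threshold (f : V -> \bar R) : \bar R :=
  ereal_sup [set lam%:E | lam in
    [set lam : R | 0 < lam /\ exists x, (-oo < moreau_env lam f x)%E]].

Definition prox_subdiff (lam : R) (f : V -> \bar R) (x : V) : set V :=
  [set v | f x \is a fin_num /\
     forall y, (f x + (dotp v (y - x) - jfun (y - x) / lam)%:E <= f y)%E].

Definition dom_prox_subdiff (lam : R) (f : V -> \bar R) : set V :=
  [set x | prox_subdiff lam f x !=set0].

Definition prox_hull (lam : R) (f : V -> \bar R) (x : V) : \bar R :=
  (- moreau_env lam (fun y => - moreau_env lam f y) x)%E.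

(* convexity of an extended-real-valued function (convex epigraph) *)
Definition econvex (h : V -> \bar R) : Prop :=
  forall (x y : V) (a b t : R), 0 <= t <= 1 ->
    (h x <= a%:E)%E -> (h y <= b%:E)%E ->
    (h ((1 - t) *: x + t *: y)%R <= ((1 - t) * a + t * b)%:E)%E.

Definition conv_fun (g : V -> \bar R) (x : V) : \bar R :=
  ereal_sup [set h x | h in [set h : V -> \bar R | econvex h /\ forall z, (h z <= g z)%E]].

Definition ediff (g : V -> \bar R) (x : V) : Prop :=
  (\forall y \near x, g y \is a fin_num) /\ differentiable (fine \o g) x.

End Defs.

(* Main.v *)
Require Import Defs.
From HB Require Import structures.
From mathcomp Require Import all_boot all_order all_algebra.
From mathcomp Require Import all_classical all_reals all_analysis.
From mathcomp Require Import ring lra.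
Import Order.TTheory GRing.Theory Num.Theory.
Import numFieldNormedType.Exports.
Local Open Scope classical_set_scope.
Local Open Scope ring_scope.

(** Put g = f + j / lam. Completing the square, v is a lam-proximal subgradient
    of f at x iff w = v + x / lam is a subgradient of g at x, i.e. an affine
    function of slope w touches g from below at x; such functions also minorize
    conv g, and e_lam f (x + lam v) = f x + lam j(v) makes the hull h_lam f lie
    above the corresponding concave quadratic. Since both conv g and
    h_lam f + j / lam are pinched between these minorants and g, they agree with
    g at x, and differentiability forces v to be the gradient, hence unique.

    Conversely, let w be the only subgradient of the convex function
    phi = conv g at x. If phi had a one-sided directional derivative other than
    <w, d>, a finite-dimensional separation argument would give a second
    subgradient. Hence psi h = phi (x + h) - phi x - <w, h>, which is convex and
    nonnegative, is o(t) along the coordinate axes, and by convexity o(|h|).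
    The case of h_lam f follows since h_lam f + j / lam is a convex minorant of
    g, thus lies below phi. *)

(** * Dot product and the quadratic j *)

Section DotProduct.
Context {R : realType} {n : nat}.
Implicit Types (u v w h : 'rV[R]_n) (c : R).

Lemma dotpC u v : dotp u v = dotp v u.
Proof. by apply: eq_bigr => i _; rewrite mulrC. Qed.

Lemma dotpDr u v w : dotp u (v + w) = dotp u v + dotp u w.
Proof. by rewrite -big_split; apply: eq_bigr => i _; rewrite mxE mulrDr. Qed.

Lemma dotpZr c u v : dotp u (c *: v) = c * dotp u v.
Proof. by rewrite mulr_sumr; apply: eq_bigr => i _; rewrite mxE mulrCA. Qed.

Lemma dotpDl u v w : dotp (u + v) w = dotp u w + dotp v w.
Proof. by rewrite dotpC dotpDr !(dotpC w). Qed.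

Lemma dotpZl c u v : dotp (c *: u) v = c * dotp u v.
Proof. by rewrite dotpC dotpZr dotpC. Qed.

Lemma dotpNr u v : dotp u (- v) = - dotp u v.
Proof. by rewrite -scaleN1r dotpZr mulN1r. Qed.

Lemma dotpNl u v : dotp (- u) v = - dotp u v.
Proof. by rewrite dotpC dotpNr dotpC. Qed.

Lemma dotpBr u v w : dotp u (v - w) = dotp u v - dotp u w.
Proof. by rewrite dotpDr dotpNr. Qed.

Lemma dotpBl u v w : dotp (u - v) w = dotp u w - dotp v w.
Proof. by rewrite dotpDl dotpNl. Qed.

Lemma dotp0r u : dotp u 0 = 0.
Proof. by rewrite -(scale0r 0) dotpZr mul0r. Qed.

Lemma dotp0l u : dotp 0 u = 0.
Proof. by rewrite dotpC dotp0r. Qed.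

Lemma dotp_ge0 u : 0 <= dotp u u.
Proof. by apply: sumr_ge0 => i _; rewrite -expr2 sqr_ge0. Qed.

Lemma dotp_eq0 u : dotp u u = 0 -> u = 0.
Proof.
move=> /psumr_eq0P u0; apply/rowP => i; rewrite mxE; apply/eqP.
by rewrite -sqrf_eq0 expr2 u0// => k _; rewrite -expr2 sqr_ge0.
Qed.

Lemma ler_coord_norm h i : `|h ord0 i| <= `|h|.
Proof.
by rewrite [leRHS]/Num.norm /= mx_normrE; apply/bigmax_geP; right; exists (ord0, i).
Qed.

(** The norm on row vectors is the maximum norm, hence the factor n. *)
Lemma dotp_le_sqr_norm h : dotp h h <= n%:R * `|h| ^+ 2.
Proof.
rewrite -[n in n%:R]card_ord mulr_natl -sumr_const ler_sum// => i _.
by rewrite -expr2 -real_normK ?num_real// lerXn2r ?nnegrE// ler_coord_norm.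
Qed.

Lemma dotp_linear u : linear (dotp u).
Proof. by move=> c v w; rewrite dotpDr dotpZr. Qed.

Lemma dotp_continuousl v : continuous (fun u => dotp u v).
Proof.
apply: continuous_big => [|i _ u]; first exact: add_continuous.
by apply: continuousM; [exact: coord_continuous|exact: cst_continuous].
Qed.

Lemma dotp_continuousr v : continuous (dotp v).
Proof.
rewrite (_ : dotp v = (fun u => dotp u v)); first exact: dotp_continuousl.
by apply/funext => u; rewrite dotpC.
Qed.

Lemma jfunD u v : jfun (u + v) = jfun u + dotp u v + jfun v.
Proof. by rewrite /jfun !dotpDl !dotpDr (dotpC v u); field. Qed.

Lemma jfunZ c u : jfun (c *: u) = c ^+ 2 * jfun u.
Proof. by rewrite /jfun dotpZl dotpZr expr2 !mulrA. Qed.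

Lemma jfunN u : jfun (- u) = jfun u.
Proof. by rewrite -scaleN1r jfunZ sqrrN expr1n mul1r. Qed.

Lemma jfun_ge0 u : 0 <= jfun u.
Proof. by rewrite divr_ge0 ?dotp_ge0. Qed.

End DotProduct.

(** * Separation of a convex cone from the origin *)

Section Separation.
Context {R : realType}.

(** Fourier-Motzkin elimination of t: each c gives a lower bound - a c / g c, the condition on [al]
    gives an upper bound, and the last hypothesis says that each lower bound is compatible with
    it. *)
Lemma exists_shift_gt0 (T : eqType) (s : seq T) (a g : T -> R) (al be : R) :
  0 <= be -> (exists t, 0 < al - t * be) ->
  (forall c, c \in s -> 0 < g c) ->
  (forall c, c \in s -> 0 < be * a c + g c * al) ->
  exists t, 0 < al - t * be /\ forall c, c \in s -> 0 < a c + t * g c.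
Proof.
move=> be0 [t0 t0P]; elim: s => [|c s IHs] gs ags; first by exists t0.
have [c' c's|c' c's|t [tP ts]] := IHs.
- by apply: gs; rewrite inE c's orbT.
- by apply: ags; rewrite inE c's orbT.
have gc := gs c (mem_head _ _); have agc := ags c (mem_head _ _).
have [tc|tc] := ltP 0 (a c + t * g c).
  by exists t; split=> // c'; rewrite inE => /predU1P[->//|/ts].
pose q := (be * a c + g c * al) / g c.
have q0 : 0 < q by rewrite divr_gt0.
have b10 : 0 < be + 1 by lra.
(* [q] is the slack al + be * a c / g c. Exceeding the new lower bound by q / (be + 1) leaves the
   same amount free on the other side, also when [be] is 0. *)
pose t' := - (a c / g c) + q / (be + 1).
have tt' : t < t'.
  have : t <= - (a c / g c) by rewrite -mulNr ler_pdivlMr//; lra.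
  have : 0 < q / (be + 1) by rewrite divr_gt0.
  by rewrite /t'; lra.
exists t'; split.
  have -> : al - t' * be = q / (be + 1).
    by rewrite /t' /q; field; rewrite !gt_eqF.
  by rewrite divr_gt0.
move=> c'; rewrite inE => /predU1P[->|c's].
  have -> : a c + t' * g c = q / (be + 1) * g c.
    by rewrite /t'; field; rewrite !gt_eqF.
  by rewrite mulr_gt0// divr_gt0.
have := ts _ c's; move/lt_trans; apply; rewrite ltrD2l ltr_pM2r//.
by apply: gs; rewrite inE c's orbT.
Qed.

Context {n : nat}.
Variable K : set 'rV[R]_n.
Hypothesis KD : forall c d, K c -> K d -> K (c + d).
Hypothesis KZ : forall t c, 0 < t -> K c -> K (t *: c).
Hypothesis K0 : ~ K 0.

(* Gordan's alternative by induction on the number of vectors: if [u] is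
   positive on all of them but [c0], slide each of the others along [c0] into
   the hyperplane orthogonal to [u]; the slid vectors still belong to the
   cone. *)
Lemma finite_strict_separation (s : seq 'rV[R]_n) :
  (forall c, c \in s -> K c) ->
  exists u, forall c, c \in s -> 0 < dotp u c.
Proof.
have [m] := ubnP (size s); elim: m s => // m IHm [|c0 s] sm Ks.
  by exists 0.
have Kc0 : K c0 by apply: Ks; rewrite mem_head.
have Kss c : c \in s -> K c by move=> cs; apply: Ks; rewrite inE cs orbT.
have [u us] := IHm s sm Kss.
have [uc0|uc0] := ltP 0 (dotp u c0).
  by exists u => c; rewrite inE => /predU1P[->//|/us].
pose be := - dotp u c0; have be0 : 0 <= be by rewrite oppr_ge0.
have [||u' u's] :=
    IHm [seq be *: c + dotp u c *: c0 | c <- s]; first by rewrite size_map.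
  move=> _ /mapP[c cs ->].
  have Kuc : K (dotp u c *: c0) by apply: KZ => //; apply: us.
  have := be0; rewrite le_eqVlt => /predU1P[<-|be_gt0].
    by rewrite scale0r add0r.
  by apply: KD => //; apply: KZ => //; apply: Kss.
have u's2 c : c \in s -> 0 < be * dotp u' c + dotp u c * dotp u' c0.
  by move=> cs; rewrite -!dotpZr -dotpDr; apply: u's; apply/mapP; exists c.
have [s0|[c1 c1s]] : s = [::] \/ exists c1, c1 \in s.
    by case: (s) => [|c1 s']; [left|right; exists c1; rewrite mem_head].
  exists c0 => c; rewrite s0 mem_seq1 => /eqP ->.
  rewrite lt_neqAle dotp_ge0 andbT; apply/eqP => /esym/dotp_eq0 c00.
  by apply: K0; rewrite -c00.
have [|t [tc0 ts]] := @exists_shift_gt0 _ s (dotp u') (dotp u)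
  (dotp u' c0) be be0 _ us u's2; last first.
  exists (u' + t *: u) => c; rewrite inE dotpDl dotpZl => /predU1P[->|/ts//].
  by move: tc0; rewrite mulrN opprK.
(* It remains to satisfy the condition at [c0] alone. If [be] is 0, [u'] is already positive there;
   otherwise t is chosen to make the value 1. *)
have := be0; rewrite le_eqVlt => /predU1P[be00|be_gt0].
  have := u's2 _ c1s; rewrite -be00 mul0r add0r pmulr_rgt0 ?us// => c0_gt0.
  by exists 0; rewrite mul0r subr0.
by exists ((dotp u' c0 - 1) / be); rewrite divfK ?gt_eqF//; lra.
Qed.

(** Compactness of the unit sphere: the closed sets of unit u with 0 <= <u, c> have the finite
    intersection property by [finite_strict_separation]. *)
Lemma cone_separation : K !=set0 ->
  exists u, u != 0 /\ forall c, K c -> 0 <= dotp u c.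
Proof.
move=> [c0 Kc0].
pose S := [set u : 'rV[R]_n | `|u| = 1].
have Scpt : compact S.
  apply: bounded_closed_compact.
    by exists 1; split=> // M M1 u /= ->; apply: ltW.
  apply: (@closed_comp _ _ (fun u : 'rV[R]_n => `|u|) [set 1]).
    by move=> u _; apply: norm_continuous.
  exact: closed_eq.
pose f c := S `&` [set u | 0 <= dotp u c].
have fcl : closed_fam_of S K f.
  exists (fun c => [set u | 0 <= dotp u c]) => // c _.
  apply: (@closed_comp _ _ (fun u => dotp u c) [set x | 0 <= x]).
    by move=> u _; apply: dotp_continuousl.
  exact: closed_ge.
have ffin : finI K f.
  move=> D DK.
  (* Adding [c0] to the list forces u to be nonzero even when [D] is empty. *)
  have [c|u us] := @finite_strict_separation (c0 :: finmap.enum_fset D).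
    by rewrite inE => /predU1P[->//|/DK]; rewrite inE.
  have u0 : u != 0.
    by apply/eqP => u0; have := us c0 (mem_head _ _); rewrite u0 dotp0l ltxx.
  exists (`|u|^-1 *: u) => c /= cD; split.
    by rewrite /S /= normrZ normfV normr_id mulVf// normr_eq0.
  rewrite /= dotpZl mulr_ge0 ?invr_ge0// ltW// us// inE.
  by apply/orP; right.
move: Scpt; rewrite compact_In0 => /(_ _ _ _ fcl ffin)[u uK].
exists u; split=> [|c /uK[]//].
by have [+ _] := uK _ Kc0; apply: contra_eq_neq => ->; rewrite normr0 eq_sym oner_eq0.
Qed.

End Separation.

(** The upper half of a first-order expansion. The lower half will come from an affine or quadratic
    minorant, while the upper half passes to any smaller function with the same value at x. *)
Definition first_order_le {R : realType} {n : nat} (F : 'rV[R]_n -> \bar R)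
    (x : 'rV[R]_n) (a : R) (v : 'rV[R]_n) : Prop :=
  forall eps : R, 0 < eps ->
    \forall h \near (0 : 'rV[R]_n), (F (x + h)%R <= (a + dotp v h + eps * `|h|)%:E)%E.

(** * A unique subgradient of a convex function gives a first-order expansion *)

Section UniqueSubgradient.
Context {R : realType} {n : nat}.
Variables (phi : 'rV[R]_n -> \bar R) (x : 'rV[R]_n) (a : R) (w : 'rV[R]_n).
Hypothesis phi_convex : econvex phi.
Hypothesis phi_x : phi x = a%:E.
Hypothesis w_minorant : forall y, ((a + dotp w (y - x))%:E <= phi y)%E.
Hypothesis w_unique : forall u,
  (forall y, ((a + dotp u (y - x))%:E <= phi y)%E) -> u = w.

(* [excess h r] says [psi h <= r], where [psi h := phi (x + h) - a - <w, h>]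
   is nonnegative, convex, and vanishes at 0. *)
Let excess (h : 'rV[R]_n) (r : R) : Prop :=
  (phi (x + h)%R <= (a + dotp w h + r)%:E)%E.

Let excess_ge0 {h r} : excess h r -> 0 <= r.
Proof.
move=> /(le_trans (w_minorant _)); rewrite lee_fin [_ + h]addrC addrK.
lra.
Qed.

Let excessW {h r} r' : r <= r' -> excess h r -> excess h r'.
Proof. by move=> rr' /le_trans; apply; rewrite lee_fin lerD2l. Qed.

Let excess0 : excess 0 0.
Proof. by rewrite /excess !addr0 dotp0r addr0 phi_x. Qed.

Let excess_convex {h1 h2 r1 r2} t : 0 <= t <= 1 -> excess h1 r1 -> excess h2 r2 ->
  excess ((1 - t) *: h1 + t *: h2) ((1 - t) * r1 + t * r2).
Proof.
move=> t01 e1 e2; have := phi_convex _ _ _ _ _ t01 e1 e2; rewrite /excess.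
have -> : (1 - t) *: (x + h1) + t *: (x + h2) =
    x + ((1 - t) *: h1 + t *: h2).
  by rewrite !scalerDr addrACA -scalerDl subrK scale1r.
move=> /le_trans; apply; rewrite lee_fin dotpDr !dotpZr.
by rewrite le_eqVlt; apply/orP; left; apply/eqP; ring.
Qed.

Let excess_shrink {h r t} : 0 <= t <= 1 -> excess h r -> excess (t *: h) (t * r).
Proof.
by move=> t01 /(excess_convex t t01 excess0); rewrite scaler0 mulr0 !add0r.
Qed.

(** Since psi is convex and psi 0 = 0, the quotient psi (s d) / s is nondecreasing in s > 0. *)
Let excess_radial {d c s t} : 0 < t -> 0 <= s <= t ->
  excess (t *: d) (c * t) -> excess (s *: d) (c * s).
Proof.
move=> t0 /andP[s0 st] e.
have st01 : 0 <= s / t <= 1.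
  by rewrite divr_ge0 ?(ltW t0)//= ler_pdivrMr// mul1r.
have := excess_shrink st01 e; rewrite scalerA divfK ?gt_eqF//.
by rewrite mulrCA divfK ?gt_eqF.
Qed.

(* If the directional derivative of psi in direction d were at least c > 0, the
   point d / c would lie outside the convex set of all h with
   psi (t h) <= t for some t > 0; a separating functional, suitably scaled,
   could then be added to w, contradicting uniqueness. *)
Let excess_direction d c : 0 < c -> exists2 t, 0 < t & excess (t *: d) (c * t).
Proof.
move=> c0; apply: contrapT => noex.
pose A h := exists2 t, 0 < t & excess (t *: h) t.
have A0 : A 0 by exists 1; rewrite // scaler0; apply: excessW excess0.
have A_convex h1 h2 t : 0 <= t <= 1 -> A h1 -> A h2 ->
    A ((1 - t) *: h1 + t *: h2).
  move=> t01 [t1 t10 e1] [t2 t20 e2].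
  pose s := Num.min t1 t2.
  have s0 : 0 < s by rewrite lt_min t10.
  exists s => //.
  have e1s : excess (s *: h1) s.
    rewrite -[X in excess _ X]mul1r; apply: (excess_radial t10).
      by rewrite ltW//= ge_min lexx.
    by rewrite mul1r.
  have e2s : excess (s *: h2) s.
    rewrite -[X in excess _ X]mul1r; apply: (excess_radial t20).
      by rewrite ltW//= ge_min lexx orbT.
    by rewrite mul1r.
  have := excess_convex _ t01 e1s e2s.
  by rewrite -mulrDl subrK mul1r scalerDr !scalerA !(mulrC s).
pose d' := c^-1 *: d.
have nAd' : ~ A d'.
  move=> [t t0 e]; apply: noex; exists (t / c); rewrite ?divr_gt0//.
  by rewrite mulrCA divff ?gt_eqF// mulr1 -scalerA.
(* The convex cone generated by d' - A; it misses 0 because d' is not in [A]. *)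
pose K := [set k | exists s h, [/\ 0 < s, A h & k = s *: (d' - h)]].
have KD c1 c2 : K c1 -> K c2 -> K (c1 + c2).
  move=> [s1 [h1 [s10 A1 ->]]] [s2 [h2 [s20 A2 ->]]].
  have s12 : 0 < s1 + s2 by rewrite addr_gt0.
  pose t := s2 / (s1 + s2).
  exists (s1 + s2), ((1 - t) *: h1 + t *: h2); split=> //.
    apply: A_convex => //.
    by rewrite /t divr_ge0 ?(ltW s20) ?(ltW s12)//= ler_pdivrMr// mul1r lerDr ltW.
  rewrite !scalerBr [_ *: d' in RHS]scalerDl scalerDr (scalerA _ (1 - t)) (scalerA _ t).
  have -> : (s1 + s2) * (1 - t) = s1 by rewrite /t; field; rewrite gt_eqF.
  have -> : (s1 + s2) * t = s2 by rewrite /t; field; rewrite gt_eqF.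
  by rewrite opprD addrACA.
have KZ t k : 0 < t -> K k -> K (t *: k).
  move=> t0 [s [h [s0 Ah ->]]]; exists (t * s), h; split=> //.
    by rewrite mulr_gt0.
  by rewrite scalerA.
have K0 : ~ K 0.
  move=> [s [h [s0 Ah /esym/eqP]]]; rewrite scaler_eq0 gt_eqF//= subr_eq0.
  by move=> /eqP d'h; apply: nAd'; rewrite d'h.
have [|u [u0 uK]] := cone_separation _ KD KZ K0.
  by exists (1 *: (d' - 0)); exists 1, 0.
pose m := dotp u d'.
have uA h : A h -> dotp u h <= m.
  move=> Ah; rewrite -subr_ge0 -dotpBr; apply: uK.
  by exists 1, h; split; rewrite ?scale1r.
have m0 : 0 <= m by have := uA _ A0; rewrite dotp0r.
(* Scaling h by the inverse of its excess lands in [A]; the extra eps / (m + 1) keeps the scale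
   positive when r = 0. *)
have u_excess h r : excess h r -> dotp u h <= m * r.
  move=> e; have r0 := excess_ge0 e.
  apply/ler_addgt0Pr => eps eps0.
  have m1 : 0 < m + 1 by lra.
  have re : 0 < r + eps / (m + 1) by rewrite ltr_wpDl// divr_gt0.
  have /uA : A ((r + eps / (m + 1))^-1 *: h).
    exists (r + eps / (m + 1)) => //.
    rewrite scalerA divff ?gt_eqF// scale1r; apply: excessW e.
    by rewrite lerDl ltW// divr_gt0.
  rewrite dotpZr ler_pdivrMl// => /le_trans; apply.
  rewrite mulrC mulrDr lerD2l mulrCA ler_piMr ?(ltW eps0)//.
  by rewrite ler_pdivrMr//; lra.
have m1 : 0 < m + 1 by lra.
(* By [u_excess], <u, h> / (m + 1) <= psi h, so this slope is again a subgradient. Using m + 1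
   covers m = 0. *)
have /eqP : w + (m + 1)^-1 *: u = w.
  apply: w_unique => y.
  have := w_minorant y.
  case E : (phi y) => [r| |]//; last by move=> _; exact: leey.
  rewrite !lee_fin dotpDl dotpZl => _.
  have e : excess (y - x) (r - a - dotp w (y - x)).
    by rewrite /excess addrC subrK E lee_fin; lra.
  have e0 := excess_ge0 e.
  suff : (m + 1)^-1 * dotp u (y - x) <= r - a - dotp w (y - x) by lra.
  rewrite ler_pdivrMl//; apply: le_trans (u_excess _ _ e) _.
  by rewrite ler_wpM2r//; lra.
rewrite -subr_eq0 addrAC subrr add0r scaler_eq0 invr_eq0 (gt_eqF m1)/=.
exact/negP.
Qed.

Let excess_coord i eps : 0 < eps ->
  exists2 del : R, 0 < del & forall h : 'rV[R]_n, `|h| < del ->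
    excess (h ord0 i *: delta_mx ord0 i) (eps * `|h|).
Proof.
move=> eps0.
have [t1 t10 e1] := excess_direction (delta_mx ord0 i) _ eps0.
have [t2 t20 e2] := excess_direction (- delta_mx ord0 i) _ eps0.
exists (Num.min t1 t2); first by rewrite lt_min t10.
move=> h; rewrite lt_min => /andP[ht1 ht2].
have hi := ler_coord_norm h i.
apply: (@excessW _ (eps * `|h ord0 i|)); first by rewrite ler_pM2l.
have [h0|h0] := leP 0 (h ord0 i).
  rewrite -{1}(ger0_norm h0); apply: (excess_radial t10) e1.
  by rewrite normr_ge0/= (le_trans hi)// ltW.
have -> : h ord0 i *: delta_mx (ord0 : 'I_1) i = `|h ord0 i| *: (- delta_mx ord0 i).
  by rewrite scalerN -scaleNr ltr0_norm// opprK.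
apply: (excess_radial t20) e2.
by rewrite normr_ge0/= (le_trans hi)// ltW.
Qed.

(** A sum of two vectors is the midpoint of their doubles, so convexity adds one coordinate at a
    time; halving eps offsets the doubling of h. *)
Let excess_sum (s : seq 'I_n) eps : 0 < eps ->
  exists2 del : R, 0 < del & forall h : 'rV[R]_n, `|h| < del ->
    excess (\sum_(i <- s) h ord0 i *: delta_mx ord0 i) (eps * `|h|).
Proof.
elim: s eps => [|i s IHs] eps eps0.
  exists 1 => // h _; rewrite big_nil; apply: excessW excess0.
  by rewrite mulr_ge0// ltW.
have eps20 : 0 < eps / 2 by rewrite divr_gt0.
have [d1 d10 e1] := IHs _ eps20.
have [d2 d20 e2] := excess_coord i _ eps20.
exists (Num.min d1 d2 / 2); first by rewrite divr_gt0// lt_min d10.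
move=> h; rewrite ltr_pdivlMr// mulrC lt_min => /andP[h1 h2].
have norm2 : `|2 *: h| = 2 * `|h| by rewrite normrZ ger0_norm.
have := e1 (2 *: h); have := e2 (2 *: h); rewrite norm2 => /(_ h2) E2 /(_ h1) E1.
have half01 : 0 <= (2^-1 : R) <= 1 by apply/andP; split; lra.
have := excess_convex _ half01 E2 E1.
rewrite big_cons.
have -> : (1 - 2^-1) = 2^-1 :> R by field.
have halfK j : 2^-1 *: ((2 *: h) ord0 j *: delta_mx ord0 j) =
    h ord0 j *: delta_mx ord0 j :> 'rV[R]_n.
  by rewrite scalerA mxE mulKf// pnatr_eq0.
rewrite scaler_sumr halfK (eq_bigr _ (fun j _ => halfK j)).
by apply: excessW; rewrite le_eqVlt; apply/orP; left; apply/eqP; field.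
Qed.

Lemma unique_subgradient_first_order_le : first_order_le phi x a w.
Proof.
move=> eps eps0; have [del del0 e] := excess_sum (index_enum 'I_n) _ eps0.
near=> h; rewrite [h in phi (x + h)]row_sum_delta [h in dotp _ h]row_sum_delta.
apply: e; near: h. exact: (@nbhs0_lt R 'rV[R]_n).
Unshelve. all: by end_near. Qed.

End UniqueSubgradient.

(** * First-order bounds and differentiability *)

Section FirstOrder.
Context {R : realType} {n : nat}.
Variables (F : 'rV[R]_n -> \bar R) (x : 'rV[R]_n) (a : R).
Hypothesis Fx : F x = a%:E.

Lemma ediff_first_order_le : ediff F x -> exists v, first_order_le F x a v.
Proof.
move=> [Ffin dF]; pose D := 'd (fine \o F) x.
pose v : 'rV[R]_n := \row_i D (delta_mx ord0 i).
have Dv h : D h = dotp v h.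
  rewrite {1}[h]row_sum_delta linear_sum; apply: eq_bigr => i _.
  by rewrite linearZ mxE mulrC.
exists v => eps eps0.
have := diff_locally dF => /eqaddoP/(_ _ eps0) Fo.
have Ffin0 : \forall h \near (0 : 'rV[R]_n), F (x + h)%R \is a fin_num.
  move: Ffin; rewrite (near_shift 0) subr0.
  by apply: filterS => h /=; rewrite addrC.
near=> h.
have Fh : F (x + h)%R \is a fin_num by near: h.
have : `|fine (F (h + x)) - (fine (F x) + D h)| <= eps * `|h|.
  by near: h.
rewrite -(fineK Fh) lee_fin Fx/= [h + x]addrC Dv.
by move=> /(le_trans (ler_norm _)); rewrite lerBlDl.
Unshelve. all: by end_near. Qed.

Variables (C : R) (v : 'rV[R]_n).
Hypothesis C_ge0 : 0 <= C.
Hypothesis F_ge : forall h, ((a + dotp v h - C * jfun h)%:E <= F (x + h)%R)%E.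

(** At h = t d with d = v - w, the two bounds give t q <= C t^2 q / 2 + eps t |d|, where q = <d, d>.
    This fails for small t > 0 unless d = 0. *)
Lemma first_order_le_unique w : first_order_le F x a w -> w = v.
Proof.
move=> Fw; apply/eqP; rewrite eq_sym -subr_eq0; apply/negPn/negP => d0.
set d := v - w in d0; pose q := dotp d d.
have q0 : 0 < q.
  rewrite lt_neqAle dotp_ge0 andbT eq_sym.
  by apply: contra_neq d0 => /dotp_eq0.
have d10 : 0 < `|d| + 1 by rewrite ltr_wpDl.
have C10 : 0 < C + 1 by rewrite ltr_wpDl.
(* [eps] makes eps |d| < q / 2. Below, the two terms of [t] keep t d within radius [del] and make C
   t < 1. *)
pose eps := q / 2 / (`|d| + 1).
have eps0 : 0 < eps by rewrite !divr_gt0.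
have /nbhs_norm0P[del /= del0 Fdel] := Fw _ eps0.
pose t := Num.min (del / (`|d| + 1)) (C + 1)^-1.
have t0 : 0 < t by rewrite lt_min divr_gt0//= invr_gt0.
have td : `|t *: d| < del.
  rewrite normrZ gtr0_norm// (@le_lt_trans _ _ (del / (`|d| + 1) * `|d|))//.
    by rewrite ler_wpM2r// ge_min lexx.
  by rewrite -mulrA gtr_pMr// mulrC ltr_pdivrMr// mul1r ltrDl.
have Ct : C * t < 1.
  rewrite (@le_lt_trans _ _ (C / (C + 1)))//.
    by rewrite ler_wpM2l// ge_min lexx orbT.
  by rewrite ltr_pdivrMr// mul1r ltrDl.
have epsd : eps * `|d| < q / 2.
  rewrite /eps -[ltLHS]mulrA gtr_pMr ?divr_gt0// mulrC ltr_pdivrMr//.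
  by rewrite mul1r ltrDl.
have := le_trans (F_ge _) (Fdel _ td).
rewrite lee_fin !dotpZr jfunZ normrZ gtr0_norm//.
have -> : dotp v d = q + dotp w d by rewrite /q {2}/d dotpBl subrK.
rewrite /jfun -/q.
have -> : C * (t ^+ 2 * (q / 2)) = t * (C * t * (q / 2)) by ring.
have : C * t * (q / 2) < q / 2 by rewrite gtr_pMl ?divr_gt0.
move=> h1 h2.
have : t * (C * t * (q / 2) + eps * `|d|) < t * q by rewrite ltr_pM2l//; lra.
lra.
Qed.

(** F is squeezed between two finite bounds, and C * j h is O(|h|^2), so both deviations from the
    affine part are o(|h|). *)
Lemma first_order_le_ediff : first_order_le F x a v -> ediff F x.
Proof.
move=> Fv.
have Fo eps : 0 < eps -> \forall h \near (0 : 'rV[R]_n),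
    F (h + x)%R \is a fin_num /\
    `|fine (F (h + x)) - (a + dotp v h)| <= eps * `|h|.
  move=> eps0.
  have Cn0 : 0 < C * n%:R + 1 by rewrite ltr_wpDl// mulr_ge0.
  near=> h.
  have hsmall : `|h| < eps / (C * n%:R + 1).
    by near: h; apply: (@nbhs0_lt R 'rV[R]_n); rewrite divr_gt0.
  have up : (F (x + h)%R <= (a + dotp v h + eps * `|h|)%:E)%E.
    by near: h; exact: Fv.
  have := F_ge h; rewrite [h + x]addrC.
  case E : (F (x + h)) up => [r| |]//; rewrite !lee_fin => up low.
  split=> //=; rewrite ler_norml lerBlDr [_ + (a + _)]addrC up andbT.
  suff : C * jfun h <= eps * `|h| by lra.
  have : C * (dotp h h) <= C * (n%:R * `|h| ^+ 2).
    by rewrite ler_wpM2l// dotp_le_sqr_norm.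
  have : C * n%:R * `|h| * `|h| <= eps * `|h|.
    rewrite ler_wpM2r//; move: hsmall; rewrite ltr_pdivlMr//.
    have := normr_ge0 h; lra.
  have := mulr_ge0 C_ge0 (dotp_ge0 h).
  rewrite /jfun expr2; nra.
split.
  rewrite (near_shift 0) subr0.
  by apply: filterS (Fo 1 ltr01) => h [].
pose D : {linear 'rV[R]_n -> R} :=
  HB.pack (dotp v) (GRing.isLinear.Build _ _ _ _ _ (dotp_linear v)).
have Dcont : continuous D by exact: dotp_continuousr.
have DF : (fine \o F) \o shift x = cst ((fine \o F) x) + D +o_ (0 : 'rV[R]_n) (@idfun 'rV[R]_n).
  apply/eqaddoP => eps eps0; near=> h.
  suff : `|fine (F (h + x)) - (fine (F x) + dotp v h)| <= eps * `|h| by [].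
  rewrite Fx; suff [] : F (h + x)%R \is a fin_num /\
    `|fine (F (h + x)) - (a + dotp v h)| <= eps * `|h| by [].
  by near: h; apply: Fo.
by apply/diff_locallyP; rewrite (diff_unique Dcont DF).
Unshelve. all: by end_near. Qed.

End FirstOrder.

(** * Convex hull and affine minorants *)

Section ConvexHull.
Context {R : realType} {n : nat}.
Variable g : 'rV[R]_n -> \bar R.

Lemma conv_fun_le z : (conv_fun g z <= g z)%E.
Proof. by apply: ge_ereal_sup => _ [h [_ hg] <-]. Qed.

Lemma le_conv_fun h : econvex h -> (forall z, (h z <= g z)%E) ->
  forall z, (h z <= conv_fun g z)%E.
Proof. by move=> hc hg z; apply: ereal_sup_ubound; exists h. Qed.

Lemma econvex_conv_fun : econvex (conv_fun g).
Proof.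
move=> y z a b t t01 ya zb; apply: ge_ereal_sup => _ [h [hc hg] <-].
by apply: (hc) => //; apply: le_trans (le_conv_fun _ hc hg _) _.
Qed.

Lemma econvex_affine a (x w : 'rV[R]_n) :
  econvex (fun y => (a + dotp w (y - x))%:E).
Proof.
move=> y z b c t /andP[t0 t1]; rewrite !lee_fin !dotpBr dotpDr !dotpZr => yb zc.
have : (1 - t) * (a + (dotp w y - dotp w x)) <= (1 - t) * b.
  by rewrite ler_wpM2l// subr_ge0.
have : t * (a + (dotp w z - dotp w x)) <= t * c by rewrite ler_wpM2l.
lra.
Qed.

(** Affine functions are convex, so g and its convex hull have the same affine minorants. *)
Lemma affine_le_conv_fun a (x w : 'rV[R]_n) :
  (forall y, ((a + dotp w (y - x))%:E <= g y)%E) <->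
  (forall y, ((a + dotp w (y - x))%:E <= conv_fun g y)%E).
Proof.
split=> [ag y|ag y]; last exact: le_trans (ag y) (conv_fun_le y).
exact: (le_conv_fun _ (econvex_affine _ _ _) ag).
Qed.

End ConvexHull.

(** Reduces bounds on the hull to its real upper bounds, which [prox_hull_leP] describes. *)
Lemma lee_upper_bounds {R : realType} (X Y : \bar R) :
  (forall b, (Y <= b%:E)%E -> (X <= b%:E)%E) -> (X <= Y)%E.
Proof.
case: Y => [b| |] XY; [exact: XY|exact: leey|].
case: X XY => [r| |] XY //.
- by have /(_ (leNye _)) := XY (r - 1)%R; rewrite lee_fin lerBrDr gerDl ler10.
- by have /(_ (leNye _)) := XY 0.
Qed.

(** * Proximal subgradients and the proximal hull *)

Section ProximalHull.
Context {R : realType} {n : nat}.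
Variables (f : 'rV[R]_n -> \bar R) (lam : R).
Hypothesis lam_gt0 : 0 < lam.
Implicit Types x y z u v w : 'rV[R]_n.

Lemma jfun_shift x h : jfun (x + h) / lam =
  jfun x / lam + lam^-1 * dotp x h + lam^-1 * jfun h.
Proof. by rewrite jfunD; field; rewrite gt_eqF. Qed.

Lemma jfun_sub x y : jfun y / lam =
  jfun x / lam + lam^-1 * dotp x (y - x) + lam^-1 * jfun (y - x).
Proof. by rewrite -jfun_shift [x + _]addrC subrK. Qed.

Lemma prox_subdiff_affine a x v : f x = a%:E ->
  prox_subdiff lam f x v <->
  forall y, ((a + jfun x / lam + dotp (v + lam^-1 *: x) (y - x))%:E <=
             f y + (jfun y / lam)%:E)%E.
Proof.
move=> fx; split=> [[_ vf] y|vf].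
  have := leeD2r (jfun y / lam)%:E (vf y).
  rewrite fx => /(le_trans _); apply.
  rewrite -!EFinD lee_fin [jfun y / _](jfun_sub x).
  rewrite dotpDl dotpZl; lra.
split=> [|y]; first by rewrite fx.
have := vf y; rewrite fx -EFinD.
case: (f y) => [b| |]//; last by move=> _; exact: leey.
rewrite -!EFinD !lee_fin [jfun y / _](jfun_sub x).
rewrite dotpDl dotpZl; lra.
Qed.

(** The two negations turn the outer infimum into a supremum over y of e_lam f y - j (y - z) /
    lam. *)
Lemma prox_hull_leP z b : (prox_hull lam f z <= b%:E)%E <->
  forall y, (moreau_env lam f y <= (b + jfun (y - z) / lam)%:E)%E.
Proof.
rewrite /prox_hull {1}/moreau_env leeNl; split=> [bz y|bz].
  have /(le_trans bz) : (ereal_inf [set (- moreau_env lam f y +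
      (jfun (y - z) / lam)%:E)%E | y in setT] <=
      - moreau_env lam f y + (jfun (y - z) / lam)%:E)%E.
    by apply: ereal_inf_lbound; exists y.
  by case: (moreau_env lam f y) => [r| |]//=; rewrite ?leNye// !lee_fin; lra.
apply: le_ereal_inf_tmp => _ [y _ <-]; have := bz y.
by case: (moreau_env lam f y) => [r| |]//=; rewrite ?leey// !lee_fin; lra.
Qed.

Lemma prox_hull_le z : (prox_hull lam f z <= f z)%E.
Proof.
apply: lee_upper_bounds => b fb; apply/prox_hull_leP => y.
have /le_trans : (moreau_env lam f y <= f z + (jfun (z - y) / lam)%:E)%E.
  by apply: ereal_inf_lbound; exists z.
by apply; rewrite -opprB jfunN EFinD leeD2r.
Qed.

Lemma prox_hull_ge a x v h : f x = a%:E -> prox_subdiff lam f x v ->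
  ((a + dotp v h - lam^-1 * jfun h)%:E <= prox_hull lam f (x + h)%R)%E.
Proof.
move=> fx [_ vf]; apply: lee_upper_bounds => b /prox_hull_leP.
(* The envelope at x + lam v is attained at x. *)
pose y0 := x + lam *: v; move=> /(_ y0).
have env_y0 : ((a + lam * jfun v)%:E <= moreau_env lam f y0)%E.
  apply: le_ereal_inf_tmp => _ [u _ <-].
  have E : jfun (u - y0) / lam =
      jfun (u - x) / lam - dotp v (u - x) + lam * jfun v.
    rewrite /y0 opprD addrA (jfunD (u - x)) jfunN jfunZ dotpNr dotpZr (dotpC v).
    by field; rewrite gt_eqF.
  have := vf u; rewrite fx E -EFinD.
  case: (f u) => [r| |]//; last by move=> _; exact: leey.
  rewrite -EFinD !lee_fin; lra.
move=> /(le_trans env_y0); rewrite !lee_fin.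
have -> : jfun (y0 - (x + h)) / lam =
    lam * jfun v - dotp v h + lam^-1 * jfun h.
  rewrite /y0 opprD addrACA subrr add0r jfunD jfunN jfunZ dotpNr dotpZl.
  by field; rewrite gt_eqF.
lra.
Qed.

(** Adding j z / lam cancels the term quadratic in z, leaving a supremum over y of functions affine
    in z. *)
Lemma econvex_prox_hullD :
  econvex (fun z => (prox_hull lam f z + (jfun z / lam)%:E)%E).
Proof.
have hullP z b : (prox_hull lam f z + (jfun z / lam)%:E <= b%:E)%E <->
    forall y, (moreau_env lam f y <=
               (b + jfun y / lam - lam^-1 * dotp y z)%:E)%E.
  rewrite -leeBrDr// -EFinB prox_hull_leP.
  have E y : b - jfun z / lam + jfun (y - z) / lam =
      b + jfun y / lam - lam^-1 * dotp y z.
    by rewrite jfunD jfunN dotpNr; field; rewrite gt_eqF.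
  by split=> H y; have := H y; rewrite E.
move=> y z b c t /andP[t0 t1] /hullP yb /hullP zc; apply/hullP => u.
have := yb u; have := zc u.
case: (moreau_env lam f u) => [r| |]//; last by rewrite !leNye.
rewrite !lee_fin dotpDr !dotpZr => rc rb.
have : (1 - t) * r <= (1 - t) * (b + jfun u / lam - lam^-1 * dotp u y).
  by rewrite ler_wpM2l// subr_ge0.
have : t * r <= t * (c + jfun u / lam - lam^-1 * dotp u z).
  by rewrite ler_wpM2l.
lra.
Qed.

Lemma prox_hull_le_conv_fun z : (prox_hull lam f z + (jfun z / lam)%:E <=
  conv_fun (fun y => (f y + (jfun y / lam)%:E)%E) z)%E.
Proof.
apply: (le_conv_fun _ _ econvex_prox_hullD) => y.
by rewrite leeD2r// prox_hull_le.
Qed.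

End ProximalHull.

Theorem mainTheorem7 (R : realType) (n : nat) (f : 'rV[R]_n -> \bar R)
  (lam : R) (x : 'rV[R]_n) :
  proper_fun f -> lower_semicontinuous f -> prox_bounded f ->
  (0%:E < prox_threshold f)%E ->
  0 < lam -> (lam%:E < prox_threshold f)%E ->
  dom_prox_subdiff lam f x ->
  [<-> (exists v, prox_subdiff lam f x = [set v]);
       ediff (conv_fun (fun y => (f y + (jfun y / lam)%:E)%E)) x /\
         conv_fun (fun y => (f y + (jfun y / lam)%:E)%E) x = (f x + (jfun x / lam)%:E)%E;
       ediff (prox_hull lam f) x /\ prox_hull lam f x = f x].
Proof.
move=> _ _ _ _ lam0 _ [v0 v0f].
have [/fineK] := v0f; move: (fine (f x)) => a /esym fx _.
set g := fun y => (f y + (jfun y / lam)%:E)%E.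
have gx : g x = (a + jfun x / lam)%:E by rewrite /g fx.
have subdiffP v := prox_subdiff_affine f lam lam0 a x v fx.
have hull_ge v := prox_hull_ge f lam lam0 a x v ^~ fx.
have conv_ge v : prox_subdiff lam f x v -> forall y,
    ((a + jfun x / lam + dotp (v + lam^-1 *: x) (y - x))%:E <=
     conv_fun g y)%E.
  by move=> /subdiffP/affine_le_conv_fun.
have convx : conv_fun g x = g x.
  apply/eqP; rewrite eq_le conv_fun_le gx /=.
  by have := conv_ge _ v0f x; rewrite subrr dotp0r addr0.
have hullx : prox_hull lam f x = a%:E.
  apply/eqP; rewrite eq_le -{1}fx prox_hull_le//=.
  have := hull_ge v0 0 v0f.
  by rewrite addr0 dotp0r /jfun dotp0r mul0r mulr0 subr0 addr0.
have lamV_ge0 : 0 <= lam^-1 by rewrite invr_ge0 ltW.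
have hull_grad v w : prox_subdiff lam f x v ->
    first_order_le (prox_hull lam f) x a w -> w = v.
  move=> vf; apply: (first_order_le_unique _ _ _ _ _ lamV_ge0) => h.
  exact: hull_ge.
tfae.
- move=> [v fv].
  have vf : prox_subdiff lam f x v by rewrite fv.
  split=> //; rewrite gx in convx.
  (* The minorant of the convex hull is affine, so the curvature constant is 0. *)
  apply: (first_order_le_ediff _ _ _ convx 0 (v + lam^-1 *: x) (lexx 0)) => [h|].
    by have := conv_ge _ vf (x + h); rewrite mul0r subr0 [x + h]addrC addrK.
  apply: unique_subgradient_first_order_le convx _ _ => //.
  - exact: econvex_conv_fun.
  - exact: conv_ge.
  move=> u /(affine_le_conv_fun _ _ _ _).2 ug.
  have : prox_subdiff lam f x (u - lam^-1 *: x).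
    by apply/subdiffP => y; rewrite subrK; exact: ug.
  by rewrite fv => /= <-; rewrite subrK.
- move=> [dconv _]; split; last by rewrite hullx.
  rewrite gx in convx.
  have [w cw] := ediff_first_order_le _ _ _ convx dconv.
  apply: (first_order_le_ediff _ _ _ hullx lam^-1 v0 lamV_ge0) => [h|].
    exact: hull_ge.
  (* Subtracting j / lam lowers the slope by x / lam; the remaining - j h / lam is nonpositive and
     is dropped. [hull_grad] then identifies the slope with [v0]. *)
  suff hw : first_order_le (prox_hull lam f) x a (w - lam^-1 *: x).
    by rewrite -(hull_grad _ _ v0f hw).
  move=> eps eps0; have := cw _ eps0; apply: filterS => h.
  move=> /(le_trans (prox_hull_le_conv_fun _ _ lam0 _)).
  rewrite -leeBrDr// -EFinB => /le_trans; apply; rewrite lee_fin.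
  rewrite jfun_shift// dotpBl dotpZl.
  have := mulr_ge0 lamV_ge0 (jfun_ge0 h); lra.
(* Every proximal subgradient equals the gradient [w] of the hull, in particular [v0]. *)
- move=> [dhull _]; exists v0; apply/seteqP; split=> [v vf|_ ->//].
  have [w hw] := ediff_first_order_le _ _ _ hullx dhull.
  by rewrite /= -(hull_grad _ _ vf hw) -(hull_grad _ _ v0f hw).
Qed.
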